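(* Let $a,b \ge 1$ be integers. There exists $C=C(a,b)\ge 0$ such that every $n$-vertex graph $G$ that is $bK_a$-free satisfies $$i(G) \le n^C\cdot \alpha^{2a\alpha},$$ where $\alpha=\alpha(G)$.
   Context: $bK_a$ denotes the disjoint union of $b$ copies of the complete graph $K_a$. A graph is $H$-free if it does not contain $H$ as an induced subgraph. $\alpha(G)$ is the independence number of $G$, and $i(G)$ is the number of independent sets of $G$, where the empty set is counted as an independent set.
   Formalization: The bound is proved for graphs with n ≥ 2 vertices; as written it fails for the one-vertex graph when ab ≥ 2 (i(G) = 2 but n^C·α^{2aα} = 1), and for the null graph whenever C > 0. *)

(* Defs.v *)
From mathcomp Require Import all_boot.

Set Implicit Arguments.
Unset Strict Implicit.
Unset Printing Implicit Defensive.

Record sgraph := SGraph {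
  vertex :> finType;
  adj : rel vertex;
  adj_sym : symmetric adj;
  adj_irrefl : irreflexive adj
}.

Section Complete.
Variable a : nat.

Definition complete_adj : rel 'I_a := fun x y => x != y.

Lemma complete_adj_sym : symmetric complete_adj.
Proof. by move=> x y; rewrite /complete_adj eq_sym. Qed.

Lemma complete_adj_irrefl : irreflexive complete_adj.
Proof. by move=> x; rewrite /complete_adj eqxx. Qed.

Definition complete : sgraph := SGraph complete_adj_sym complete_adj_irrefl.

End Complete.

Section Copies.
Variables (b : nat) (H : sgraph).

(* The first component of a vertex is the index of the copy it lies in. *)
Definition copies_adj : rel ('I_b * H)%type :=
  fun u v => (u.1 == v.1) && adj u.2 v.2.

Lemma copies_adj_sym : symmetric copies_adj.
Proof. by move=> u v; rewrite /copies_adj eq_sym adj_sym. Qed.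

Lemma copies_adj_irrefl : irreflexive copies_adj.
Proof. by move=> u; rewrite /copies_adj adj_irrefl andbF. Qed.

Definition copies : sgraph := SGraph copies_adj_sym copies_adj_irrefl.

End Copies.

Definition contains_induced (H G : sgraph) : Prop :=
  exists f : H -> G, injective f /\ forall x y : H, adj (f x) (f y) = adj x y.

Definition induced_free (H G : sgraph) : Prop := ~ contains_induced H G.

Definition independent (G : sgraph) (S : {set G}) : bool :=
  [forall x in S, forall y in S, ~~ adj x y].

Definition indep_number (G : sgraph) : nat :=
  \max_(S : {set G} | independent S) #|S|.

Definition num_indep (G : sgraph) : nat :=
  #|[set S : {set G} | independent S]|.

(* Main.v *)
(* Let N_b(A) count the ordered b-tuples of pairwise non-adjacent a-cliques of
   a vertex set A, and let R bound the size of a K_a-free set, by Ramsey. If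
   N_{b+1}(A) = 0, then deleting the closed neighbourhood of any such b-tuple
   leaves a K_a-free set, so double counting gives
     sum_{p in A} N_b(A \ N[p]) <= R * N_b(A).
   Hence some p satisfies N_b(A \ N[p]) <= (R / |A|) * N_b(A). As long as
   |A| > R^2, branching on such a p, i(A) <= i(A - p) + i(A \ N[p]), yields
   i(A) <= K * (|A| + 1)^c * (1 + (|A| + 1) * N_b(A)^2), where K bounds i on
   sets of at most R^2 vertices and K * (|A| + 1)^c is the bound obtained for
   N_b(A) = 0 by induction on b. Since N_b(A) <= |A|^(a * b), this is K times a
   power of |A| + 1; and R = alpha^a - alpha gives K <= alpha^(2 * a * alpha). *)

Require Import Defs.
From mathcomp Require Import all_boot zify.

Set Implicit Arguments.
Unset Strict Implicit.
Unset Printing Implicit Defensive.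

(** * Estimates for binomials and powers *)

Lemma bin_le_expn n m : 'C(n, m) <= n ^ m.
Proof.
elim: m => [|m IHm]; first by rewrite bin0.
apply: (@leq_trans (m.+1 * 'C(n, m.+1))); first by rewrite leq_pmull.
by rewrite mul_bin_left expnS leq_mul // leq_subr.
Qed.

Lemma leq_expn2r m n e : m <= n -> m ^ e <= n ^ e.
Proof. by case: e => // e; rewrite leq_exp2r. Qed.

(** * Cliques, closed neighbourhoods and independent sets *)

Section Graph.
Variable G : sgraph.
Implicit Types (A B Q S T : {set G}) (p v x y : G).

Definition clique Q := [forall x in Q, forall y in Q, (x != y) ==> adj x y].

Definition closed_nbhd Q : {set G} :=
  [set y | [exists x in Q, (x == y) || adj x y]].

Definition indep_in A : {set {set G}} :=
  [set S : {set G} | S \subset A & independent S].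

Lemma cliqueP Q :
  reflect {in Q &, forall x y, x != y -> adj x y} (clique Q).
Proof.
apply: (iffP forall_inP) => [cQ x y xQ yQ|cQ x xQ].
  by move/forall_inP: (cQ x xQ) => /(_ y yQ)/implyP.
by apply/forall_inP => y yQ; apply/implyP; apply: cQ.
Qed.

Lemma independentP S :
  reflect {in S &, forall x y, ~~ adj x y} (independent S).
Proof.
apply: (iffP forall_inP) => [iS x y xS yS|iS x xS].
  by move/forall_inP: (iS x xS) => /(_ y yS).
by apply/forall_inP => y yS; apply: iS.
Qed.

Lemma independent_sub S T : T \subset S -> independent S -> independent T.
Proof.
move=> /subsetP sTS /independentP iS; apply/independentP => x y xT yT.
by apply: iS; apply: sTS.
Qed.

Lemma in_closed_nbhd1 p x : (x \in closed_nbhd [set p]) = (p == x) || adj p x.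
Proof.
rewrite inE; apply/exists_inP/idP => [[y /set1P -> //]|h].
by exists p; rewrite ?set11.
Qed.

Lemma sub_closed_nbhd Q : Q \subset closed_nbhd Q.
Proof.
apply/subsetP => x xQ; rewrite inE; apply/exists_inP.
by exists x; rewrite ?eqxx.
Qed.

(** By symmetry of adjacency, [Q] avoids the closed neighbourhood of [p] exactly when [p] avoids
    that of [Q]; the double counting rests on this exchange. *)
Lemma subset_D_closed_nbhd1 A Q p :
  (Q \subset A :\: closed_nbhd [set p]) =
  (Q \subset A) && (p \notin closed_nbhd Q).
Proof.
rewrite subsetD; congr andb.
rewrite disjoint_subset; apply/subsetP/idP => [h|pQ x xQ].
  rewrite inE; apply/exists_inP => -[x xQ]; apply/negP.
  by move: (h x xQ); rewrite inE in_closed_nbhd1 eq_sym adj_sym.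
rewrite inE in_closed_nbhd1; apply: contra pQ => h.
by rewrite inE; apply/exists_inP; exists x => //; rewrite eq_sym adj_sym.
Qed.

(** Induction on [k]: the sets of size [k.+1] number at most [#|A| ^ k.+1], hence at most
    [#|A| * #|A|.+1 ^ k]. *)
Lemma card_indep_in_le_exp A k :
  (forall S, independent S -> #|S| <= k) -> #|indep_in A| <= #|A|.+1 ^ k.
Proof.
move=> hk; pose D j := [set S : {set G} | S \subset A & #|S| <= j].
apply: (@leq_trans #|D k|).
  by apply/subset_leq_card/subsetP => S; rewrite !inE => /andP[-> /hk].
elim: k {hk} => [|k IHk].
  rewrite expn0 -(cards1 (set0 : {set G})); apply/subset_leq_card/subsetP => S.
  by rewrite !inE leqn0 cards_eq0 => /andP[].
have/subset_leq_card/leq_trans -> // :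
    D k.+1 \subset D k :|: [set S : {set G} | S \subset A & #|S| == k.+1].
  by apply/subsetP => S; rewrite !inE leq_eqVlt ltnS -andb_orr orbC.
rewrite (leq_trans (leq_card_setU _ _)) // cards_draws expnS mulSn leq_add //.
apply: leq_trans (bin_le_expn _ _) _.
by rewrite expnS leq_mul // leq_expn2r.
Qed.

Lemma card_indep_in_branch A p : p \in A ->
  #|indep_in A| <=
    #|indep_in (A :\ p)| + #|indep_in (A :\: closed_nbhd [set p])|.
Proof.
move=> pA; rewrite -(cardsID [set S : {set G} | p \notin S]) leq_add //.
  apply/subset_leq_card/subsetP => S; rewrite !inE subsetD1.
  by case/andP=> /andP[-> ->] ->.
(* Deleting [p] is injective on the sets that contain [p]. *)
rewrite -(card_in_imset (f := fun S => S :\ p)) => [|S T].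
  apply/subset_leq_card/subsetP => _ /imsetP[S + ->].
  rewrite !inE negbK => /and3P[pS sSA iS].
  rewrite (independent_sub (subD1set _ _) iS) andbT.
  apply/subsetP => x /setD1P[xp xS]; rewrite inE (subsetP sSA) // andbT.
  by rewrite in_closed_nbhd1 eq_sym (negPf xp) (independentP _ iS).
rewrite !inE !negbK => /andP[pS _] /andP[pT _] /(congr1 (fun X => p |: X)).
by rewrite !setD1K.
Qed.

(** * A Ramsey bound *)

Lemma ramsey k a A : 2 <= k ->
    (forall S, independent S -> #|S| <= k) ->
    (forall Q, Q \subset A -> clique Q -> #|Q| != a.+1) ->
  #|A| + k <= k ^ a.+1.
Proof.
move=> k2 hk; elim: a A => [|a IHa] A hA.
  suff -> : A = set0 by rewrite cards0 expn1.
  apply/eqP/set0Pn => -[x xA].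
  have : #|[set x]| != 1; last by rewrite cards1.
  apply: hA; first by rewrite sub1set.
  by apply/cliqueP => y z /set1P-> /set1P->; rewrite eqxx.
(* A largest independent [J] in [A] dominates [A], so [J] and the neighbourhoods of its at most [k]
   vertices cover [A]. *)
have [J /andP[sJA iJ] Jmax] : {J : {set G} | (J \subset A) && independent J &
    forall S : {set G}, (S \subset A) && independent S -> #|S| <= #|J|}.
  case: (@arg_maxnP _ set0 (fun S : {set G} => (S \subset A) && independent S)
    (fun S => #|S|)).
    by rewrite sub0set; apply/independentP => x y; rewrite inE.
  by move=> J hJ hm; exists J.
pose N v := [set x in A | adj v x].
have cardN v : v \in A -> #|N v| + k <= k ^ a.+1.
  move=> vA; apply: IHa => Q /subsetP sQN cQ; apply/negP => /eqP cardQ.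
  have vQ : v \notin Q.
    by apply/negP => /sQN; rewrite inE adj_irrefl andbF.
  have : #|v |: Q| != a.+2; last by rewrite cardsU1 vQ cardQ eqxx.
  apply: hA.
    by apply/subsetP => x /setU1P[->//|/sQN]; rewrite inE => /andP[].
  apply/cliqueP => x y /setU1P[->|xQ] /setU1P[->|yQ]; rewrite ?eqxx //.
  - by move/sQN: yQ; rewrite inE => /andP[].
  - by move/sQN: xQ; rewrite inE adj_sym => /andP[].
  - exact: (cliqueP _ cQ).
have sA : A \subset \bigcup_(v in J) (v |: N v).
  apply/subsetP => x xA; apply/bigcupP.
  have [xJ|xJ] := boolP (x \in J); first by exists x; rewrite ?setU11.
  have [/exists_inP[v vJ vx]|noadj] := boolP [exists v in J, adj v x].
    by exists v => //; rewrite !inE xA vx orbT.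
  have: #|x |: J| <= #|J|.
    apply: Jmax; rewrite subUset sub1set xA sJA /=.
    apply/independentP => y z /setU1P[->|yJ] /setU1P[->|zJ].
    - by rewrite adj_irrefl.
    - by apply: contra noadj => h; apply/exists_inP; exists z; rewrite // adj_sym.
    - by apply: contra noadj => h; apply/exists_inP; exists y.
    - exact: (independentP _ iJ).
  by rewrite cardsU1 xJ ltnn.
have: #|A| <= \sum_(v in J) (k ^ a.+1 - k).+1.
  apply: leq_trans (subset_leq_card sA) _.
  elim/big_rec2: _ => [|v U m vJ cardU]; first by rewrite cards0.
  apply: leq_trans (leq_card_setU _ _) _; apply: leq_add cardU.
  have := cardN v (subsetP sJA v vJ).
  by rewrite cardsU1; case: (v \notin _) => /=; lia.
rewrite sum_nat_const => hA1.
have : #|A| <= k * (k ^ a.+1 - k).+1.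
  by apply: leq_trans hA1 _; rewrite leq_mul // hk.
(* [k * (k ^ a.+1 - k + 1) <= k ^ a.+2 - k] amounts to [2 * k <= k ^ 2], which [2 <= k] provides. *)
have : k <= k ^ a.+1 by rewrite expnS leq_pmulr // expn_gt0; lia.
rewrite (expnS k a.+1); nia.
Qed.

(** * Counting tuples of pairwise non-adjacent cliques *)

Variable a : nat.

Definition clique_in A Q := [&& Q \subset A, #|Q| == a & clique Q].

(* Number of ordered [b]-tuples of [a]-cliques of [A] whose union induces
   a copy of [bK_a]. *)
Fixpoint ncliques b A : nat :=
  if b is b'.+1 then
    \sum_(Q | clique_in A Q) ncliques b' (A :\: closed_nbhd Q)
  else 1.

Lemma ncliques_sub b A B : A \subset B -> ncliques b A <= ncliques b B.
Proof.
elim: b A B => //= b IHb A B sAB; rewrite big_mkcond [leqRHS]big_mkcond /=.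
apply: leq_sum => Q _; rewrite /clique_in.
case: (boolP (Q \subset A)) => //= sQA; rewrite (subset_trans sQA sAB) /=.
by case: ifP => // _; apply/IHb/setSD.
Qed.

Lemma ncliques_le_exp b A : ncliques b A <= #|A| ^ (a * b).
Proof.
elim: b A => [|b IHb] A; first by rewrite muln0.
rewrite /= mulnS expnD.
apply: (@leq_trans (\sum_(Q | clique_in A Q) #|A| ^ (a * b))).
  apply: leq_sum => Q _; apply: leq_trans (IHb _) _.
  by rewrite leq_expn2r // subset_leq_card // subsetDl.
rewrite sum_nat_const leq_mul // (leq_trans _ (bin_le_expn _ _)) //.
rewrite -cards_draws; apply/subset_leq_card/subsetP => Q.
by rewrite !inE => /and3P[-> ->].
Qed.

(** Induction on [b]: exchange [p] with the first clique [Q] and recurse outside the closed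
    neighbourhood of [Q], where the count is a term of a zero sum. For [b = 0] the sum is [#|A|]. *)
Lemma sum_ncliques_le R b A :
    (forall B, B \subset A -> ncliques 1 B = 0 -> #|B| <= R) ->
    ncliques b.+1 A = 0 ->
  \sum_(p in A) ncliques b (A :\: closed_nbhd [set p]) <= R * ncliques b A.
Proof.
elim: b A => [|b IHb] A hR N0.
  by rewrite sum1_card muln1 hR.
have swap : \sum_(p in A) ncliques b.+1 (A :\: closed_nbhd [set p]) =
    \sum_(Q | clique_in A Q) \sum_(p in A :\: closed_nbhd Q)
      ncliques b ((A :\: closed_nbhd Q) :\: closed_nbhd [set p]).
  rewrite /= (exchange_big_dep (clique_in A)) /= => [|p Q pA].
    apply: eq_bigr => Q cQ; apply: eq_big => [p|p _].
      rewrite /clique_in subset_D_closed_nbhd1 in_setD.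
      by case/and3P: cQ => -> -> -> /=; rewrite !andbT andbC.
    by rewrite !setDDl setUC.
  by rewrite /clique_in subset_D_closed_nbhd1 => /and3P[/andP[-> _] -> ->].
rewrite swap /= big_distrr /=; apply: leq_sum => Q cQ; apply: IHb.
  by move=> B sB; apply: hR; apply: subset_trans sB (subsetDl _ _).
by move/eqP: N0; rewrite [ncliques _ _]/= sum_nat_eq0 => /forall_inP/(_ Q cQ)/eqP.
Qed.

(** * The branching bound *)

Fixpoint bound_exp b := if b is b'.+1 then bound_exp b' + (2 * a * b').+2 else 0.

Lemma card_indep_in_bound k R b A :
    (forall S, independent S -> #|S| <= k) ->
    (forall B, ncliques 1 B = 0 -> #|B| <= R) ->
    ncliques b A = 0 ->
  #|indep_in A| <= (R ^ 2).+1 ^ k * #|A|.+1 ^ bound_exp b.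
Proof.
move=> hk hR; set K := _ ^ k.
have small B : #|B| <= R ^ 2 -> #|indep_in B| <= K.
  move=> leB; apply: leq_trans (card_indep_in_le_exp B hk) _.
  by rewrite leq_expn2r.
have K_gt0 : 0 < K by rewrite expn_gt0.
elim: b A => // b IHb A0 N0; set c := bound_exp b in IHb.
have [/small le|] := leqP #|A0| (R ^ 2).
  by apply: leq_trans le _; rewrite leq_pmulr // expn_gt0.
move/(leq_ltn_trans (leq0n _)) => A0_gt0.
suff main A : ncliques b.+1 A = 0 ->
    #|indep_in A| <= K * #|A|.+1 ^ c * (1 + #|A|.+1 * ncliques b A ^ 2).
  apply: leq_trans (main _ N0) _; rewrite -mulnA leq_mul //=.
  rewrite -/c expnD leq_mul //; set m := #|A0|.+1.
  have le : ncliques b A0 ^ 2 <= m ^ (2 * a * b).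
    rewrite -mulnA mulnC expnM leq_exp2r //.
    by apply: leq_trans (ncliques_le_exp _ _) _; rewrite leq_expn2r.
  (* With [x = m ^ (2 * a * b)], [1 + m * x <= m ^ 2 * x] because [A0] is non-empty and so [2 <= m];
     this explains the [.+2] in [bound_exp]. *)
  have : 0 < m ^ (2 * a * b) by rewrite expn_gt0.
  have := leq_mul (leqnn m) le; rewrite !expnS; nia.
have [n] := ubnP #|A|; elim: n A {N0 A0 A0_gt0} => // n IHn A ltA N0.
have [leA|large] := leqP #|A| (R ^ 2).
  apply: leq_trans (small _ leA) _; rewrite -mulnA leq_pmulr // muln_gt0.
  by rewrite expn_gt0.
have [Nb0|Nb_gt0] := posnP (ncliques b A).
  by apply: leq_trans (IHb _ Nb0) _; rewrite leq_pmulr // Nb0.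
(* Averaging: if every [p] failed, summing over [A] would contradict [sum_ncliques_le]. *)
have [p pA hp] : exists2 p, p \in A &
    #|A| * ncliques b (A :\: closed_nbhd [set p]) <= R * ncliques b A.
  apply/exists_inP; apply: contraT => /exists_inPn noP.
  have A_gt0 : 0 < #|A| by apply: leq_ltn_trans large.
  have : \sum_(p in A) (R * ncliques b A).+1 <=
      \sum_(p in A) #|A| * ncliques b (A :\: closed_nbhd [set p]).
    by apply: leq_sum => p /noP; rewrite -ltnNge.
  rewrite sum_nat_const -big_distrr /= leq_pmul2l //.
  by move/(leq_trans)/(_ (sum_ncliques_le (fun B _ => hR B) N0)); rewrite ltnn.
apply: leq_trans (card_indep_in_branch pA) _.
have cardD1 : #|A| = #|A :\ p|.+1 by rewrite (cardsD1 p) pA.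
(* Both branches lie in [A :\ p], so [#|B|.+1 <= #|A|]. *)
have step B : B \subset A :\ p -> #|indep_in B| <=
    K * #|A| ^ c * (1 + #|A| * ncliques b B ^ 2).
  move=> sB; have leB : #|B| < #|A| by rewrite cardD1 ltnS subset_leq_card.
  apply: leq_trans (IHn B _ _) _; first exact: leq_trans leB _.
    by apply/eqP; rewrite -leqn0 -N0 ncliques_sub // (subset_trans sB) ?subD1set.
  by rewrite !leq_mul ?leq_expn2r // leq_add2l leq_mul.
set L := K * #|A| ^ c in step.
have le1 : #|indep_in (A :\ p)| <= L * (1 + #|A| * ncliques b A ^ 2).
  apply: leq_trans (step _ (subxx _)) _.
  by rewrite leq_mul // leq_add2l leq_mul // leq_sqr ncliques_sub ?subD1set.
set A' := A :\: _ in hp *.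
have sA' : A' \subset A :\ p.
  by rewrite setDS // sub_closed_nbhd.
have le2 : #|indep_in A'| <= L * ncliques b A ^ 2.
  have [N'0|N'_gt0] := posnP (ncliques b A').
    apply: leq_trans (IHb _ N'0) _.
    apply: (@leq_trans L); last by rewrite leq_pmulr // expn_gt0 Nb_gt0.
    by rewrite leq_mul // leq_expn2r // cardD1 ltnS subset_leq_card.
  (* Squaring [hp] and using [R ^ 2 < #|A|] gives [#|A| * ncliques b A' ^ 2 < ncliques b A ^ 2];
     strictness absorbs the [1 +]. *)
  apply: leq_trans (step _ sA') _; rewrite leq_mul // add1n.
  rewrite -(@ltn_pmul2l #|A|) ?(leq_ltn_trans _ large) // mulnA mulnn -expnMn.
  apply: (@leq_ltn_trans ((R * ncliques b A) ^ 2)); first by rewrite leq_sqr.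
  by rewrite expnMn ltn_pmul2r // expn_gt0 Nb_gt0.
apply: leq_trans (leq_add le1 le2) _.
rewrite -mulnDr leq_mul //; last by lia.
by rewrite leq_mul // leq_expn2r.
Qed.

(** * From tuples of cliques to an induced copy, and the theorem *)

Lemma ncliques_embedding b A : 0 < ncliques b A ->
  exists2 f : copies b (complete a) -> G,
    injective f /\ (forall u w, adj (f u) (f w) = adj u w) &
    forall u, f u \in A.
Proof.
elim: b A => [|b IHb] A /=.
  have no_vertex : copies 0 (complete a) -> False by case=> -[].
  by exists (fun u => False_rect _ (no_vertex u)); [split|] => u; case: no_vertex.
rewrite lt0n sum_nat_eq0 => /forall_inPn[Q /and3P[sQA /eqP cardQ cQ]].
rewrite -lt0n => /IHb[f [f_inj f_adj] fA].
pose q (i : 'I_a) : G := enum_val (cast_ord (esym cardQ) i).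
have qQ i : q i \in Q by apply: enum_valP.
have q_inj : injective q by move=> i j /enum_val_inj/cast_ord_inj.
(* The image of [f] lies outside the closed neighbourhood of [Q]. *)
have qf i u : (q i == f u) || adj (q i) (f u) = false.
  apply: contraTF (fA u) => h; rewrite !inE negb_and negbK; apply/orP; left.
  by apply/exists_inP; exists (q i).
have q_neq i u : (q i == f u) = false by case/norP: (negbT (qf i u)) => /negPf.
have q_nadj i u : adj (q i) (f u) = false.
  by case/norP: (negbT (qf i u)) => _ /negPf.
(* Copy [ord0] goes onto [Q], and copy [lift ord0 j] follows copy [j] of [f]. *)
exists (fun u => if unlift ord0 u.1 is Some j then f (j, u.2) else q u.2);
  last first.
  move=> [i k] /=; case: unliftP => [j|] _; last exact: (subsetP sQA).
  by have := fA (j, k); rewrite inE => /andP[].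
split=> [[i k] [j l]|[i k] [j l]] /=.
  case: unliftP => [i' ->|->]; case: unliftP => [j' ->|->] /=.
  - by move/f_inj => [-> ->].
  - by move/esym/eqP; rewrite q_neq.
  - by move/eqP; rewrite q_neq.
  - by move/q_inj => ->.
rewrite /copies_adj /=.
case: unliftP => [i' ->|->]; case: unliftP => [j' ->|->] /=.
- by rewrite f_adj /= /copies_adj /= (inj_eq lift_inj).
- by rewrite adj_sym q_nadj.
- by rewrite q_nadj.
- rewrite /complete_adj; have [->|kl] := eqVneq k l.
    by rewrite adj_irrefl.
  by rewrite (cliqueP _ cQ) // (inj_eq q_inj).
Qed.

End Graph.

(* The bound fails for every C when #|G| = 1: then num_indep G = 2 while the
   right-hand side is 1. For #|G| = 0 it fails for every C > 0. *)
Theorem theorem4p1 (a b : nat) (ha : 1 <= a) (hb : 1 <= b) :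
  exists C : nat, forall G : sgraph, 2 <= #|G| ->
    induced_free (copies b (complete a)) G ->
    num_indep G <= #|G| ^ C * indep_number G ^ (2 * a * indep_number G).
Proof.
(* The factor 2 comes from [n + 1 <= n ^ 2] for [2 <= n]; the successor covers [k = 1], where the
   number of independent sets is at most [n + 1]. *)
exists (2 * (bound_exp a b).+1) => G G2 freeG; set k := indep_number G.
have hk (S : {set G}) : independent S -> #|S| <= k.
  by move=> iS; apply: (@leq_bigmax_cond _ (@independent G) (fun S => #|S|)).
have -> : num_indep G = #|indep_in [set: G]|.
  by apply: eq_card => S; rewrite !inE subsetT.
have leG2 e : #|G|.+1 ^ e <= #|G| ^ (2 * e).
  by rewrite expnM leq_expn2r // !expnS; nia.
have [k2|k2] := leqP 2 k.
  have N0 : ncliques a b [set: G] = 0.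
    apply/eqP; rewrite eqn0Ngt; apply/negP => /ncliques_embedding[f hf _].
    by apply: freeG; exists f.
  have hR (B : {set G}) : ncliques a 1 B = 0 -> #|B| <= k ^ a - k.
    move=> /= /eqP; rewrite sum_nat_eq0 => /forall_inP noQ.
    have := @ramsey G k a.-1 B k2 hk; rewrite prednK // => le.
    suff: #|B| + k <= k ^ a by lia.
    apply: le => Q sQB cQ; apply/negP => cardQ.
    by have := noQ Q; rewrite /clique_in sQB cardQ cQ => /(_ isT).
  apply: leq_trans (card_indep_in_bound hk hR N0) _; rewrite cardsT mulnC.
  apply: leq_mul.
    by apply: leq_trans (leG2 _) _; rewrite leq_pexp2l // ?leq_mul //; lia.
  rewrite expnM; apply: leq_expn2r; rewrite mulnC expnM.
  (* Subtracting [k] in [R = k ^ a - k] leaves room for [R ^ 2 + 1 <= k ^ (2 * a)]. *)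
  have : k <= k ^ a by rewrite -(prednK ha) expnS leq_pmulr // expn_gt0; lia.
  rewrite !expnS; nia.
have [x _] : exists x : G, x \in [set: G].
  by apply/set0Pn; rewrite -card_gt0 cardsT; lia.
have k1 : k = 1.
  suff : 0 < k by lia.
  rewrite -(cards1 x); apply: hk; apply/independentP => y z /set1P-> /set1P->.
  by rewrite adj_irrefl.
apply: leq_trans (card_indep_in_le_exp _ hk) _; rewrite k1 exp1n muln1 cardsT.
by apply: leq_trans (leG2 1) _; rewrite leq_pexp2l //; lia.
Qed.
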